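(* Let $(\mathcal{A},\tau)$ be a tracial non-commutative probability space with unit ${\bf 1}$ and let $P,Q\in\mathcal{A}$ be two orthogonal projections. Set $R:=2P-{\bf 1}$, $S:=2Q-{\bf 1}$, $\alpha:=\tau(R)=2\tau(P)-1$ and $\beta:=\tau(S)=2\tau(Q)-1$. Then for any integer $j\ge 1$, $$2\tau[(PQP)^j]-\frac{\alpha+\beta}{2}=\frac{1}{2^{2j}}\,\tau[(R+S)^{2j}]=\tau[(P+Q-{\bf 1})^{2j}].$$
   Context: A tracial non-commutative probability space $(\mathcal{A},\tau)$ is a unital $*$-algebra $\mathcal{A}$ with unit ${\bf 1}$ together with a state $\tau$ ($\tau({\bf 1})=1$) satisfying $\tau(xy)=\tau(yx)$. An orthogonal projection is an element $P$ with $P=P^\star=P^2$. No freeness or general position assumption is made on $P,Q$. *)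

(* Defs.v *)
From HB Require Import structures.
From mathcomp Require Import all_boot all_order all_algebra.
From mathcomp Require Import complex.
From mathcomp Require Import reals.

Set Implicit Arguments.
Unset Strict Implicit.
Unset Printing Implicit Defensive.

Import Order.TTheory GRing.Theory Num.Theory.

Local Open Scope ring_scope.

(* The base structure algType excludes the zero algebra; this loses nothing
   here, since a unital state cannot live on the zero algebra. *)
HB.mixin Record isStarAlgebra (C : numClosedFieldType) A
    of GRing.Algebra C A := {
  star : A -> A;
  starK : involutive star;
  starD : {morph star : x y / x + y};
  starM : forall x y, star (x * y) = star y * star x;
  starZ : forall (a : C) (x : A), star (a *: x) = a^* *: star x
}.

#[short(type="starAlgType")]
HB.structure Definition StarAlgebra (C : numClosedFieldType) :=
  { A of isStarAlgebra C A & GRing.Algebra C A }.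

Section NCProbability.
Variables (C : numClosedFieldType) (A : starAlgType C).

(* The order on C is the partial one: 0 <= z means that z is real and
   nonnegative. *)
Definition is_state (tau : {scalar A}) : Prop :=
  tau 1 = 1 /\ forall x : A, 0 <= tau (star x * x).

Definition is_tracial (tau : {scalar A}) : Prop :=
  forall x y : A, tau (x * y) = tau (y * x).

Definition orthogonal_projection (P : A) : Prop :=
  P = star P /\ P = P ^+ 2.

End NCProbability.

(* Main.v *)
Require Import Defs.
From HB Require Import structures.
From mathcomp Require Import all_boot all_order all_algebra.
From mathcomp Require Import complex.
From mathcomp Require Import reals.

(** Put [X := P + Q - 1] and [Y := P - Q].  Idempotence of [P] and [Q] gives
    the two classical relations of a pair of projections,
    [Y * X = - (X * Y)] and [X ^+ 2 + Y ^+ 2 = 1], and shows that [X ^+ 2]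
    commutes with [P] and satisfies [P * X ^+ 2 = P * Q * P].  Hence
    [(P * Q * P) ^+ j = P * X ^+ (2 * j)] for [1 <= j], and since
    [P + P = 1 + X + Y], twice its trace is the sum of the traces of
    [X ^+ (2 * j)], of [X ^+ (2 * j).+1] and of [Y * X ^+ (2 * j)].

    A trace kills the product of two anticommuting elements
    ([trace_anticomm0]).  This makes the third term vanish ([trace_mul_anticomm]),
    and also gives [tau (X ^+ (2 * k).+1 * Y ^+ 2) = 0]; as [Y ^+ 2] is
    [1 - X ^+ 2], all odd moments of [X] are then equal to [tau X]
    ([trace_odd_moment]), which is half of [alpha + beta].  The equality with
    the moments of [R + S] is homogeneity, because [R + S = 2 *: X]. *)

Set Implicit Arguments.
Unset Strict Implicit.
Unset Printing Implicit Defensive.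

Import Order.TTheory GRing.Theory Num.Theory.

Local Open Scope ring_scope.

Section TwoIdempotents.
Variables (A : pzRingType) (P Q : A).
Hypotheses (idemP : P * P = P) (idemQ : Q * Q = Q).

Let X := P + Q - 1.
Let Y := P - Q.

Lemma mulPX : P * X = P * Q.
Proof. by rewrite /X mulrBr mulrDr idemP mulr1 addrAC subrr add0r. Qed.

Lemma mulQX : Q * X = Q * P.
Proof. by rewrite /X mulrBr mulrDr idemQ mulr1 addrK. Qed.

Lemma mulXP : X * P = Q * P.
Proof. by rewrite /X mulrBl mulrDl idemP mul1r addrAC subrr add0r. Qed.

Lemma mulXQ : X * Q = P * Q.
Proof. by rewrite /X mulrBl mulrDl idemQ mul1r addrK. Qed.

Lemma idem_anticomm : Y * X = - (X * Y).
Proof. by rewrite /Y mulrBl mulrBr mulPX mulQX mulXP mulXQ opprB. Qed.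

Lemma idem_sqrD : X ^+ 2 + Y ^+ 2 = 1.
Proof.
have -> : X ^+ 2 = P * Q + Q * P - X.
  by rewrite expr2 {1}/X mulrBl mulrDl mulPX mulQX mul1r.
have -> : Y ^+ 2 = P + Q - (P * Q + Q * P).
  rewrite expr2 /Y mulrBl !mulrBr idemP idemQ opprB.
  by rewrite addrACA opprD.
by rewrite addrC addrA subrK /X opprB addrC subrK.
Qed.

Lemma idem_mul_sqr : P * X ^+ 2 = P * Q * P.
Proof. by rewrite expr2 mulrA mulPX -mulrA mulQX mulrA. Qed.

Lemma idem_sqr_mul : X ^+ 2 * P = P * Q * P.
Proof. by rewrite expr2 -mulrA mulXP mulrA mulXQ. Qed.

(** [P * Q * P] is the product of [P] and [X ^+ 2], which commute, and every
    positive power of [P] is [P].  The exponent is a successor because at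
    exponent 0 the two sides are [1] and [P]. *)
Lemma idem_compression_exp j :
  (P * Q * P) ^+ j.+1 = P * X ^+ (2 * j.+1).
Proof.
have cPX : GRing.comm P (X ^+ 2) by rewrite /GRing.comm idem_mul_sqr idem_sqr_mul.
have Pexp n : P ^+ n.+1 = P by elim: n => // n IHn; rewrite exprS IHn.
by rewrite -idem_mul_sqr exprMn_comm // Pexp exprM.
Qed.

Lemma idem_double : P + P = 1 + X + Y.
Proof. by rewrite /X /Y (addrC 1) subrK addrACA subrr addr0. Qed.

End TwoIdempotents.

Section AnticommutingTrace.
Variables (C : numFieldType) (A : algType C) (tau : {scalar A}).
Hypothesis tauC : forall x y : A, tau (x * y) = tau (y * x).

(** Traciality makes [tau (x * y)] its own opposite, and the field [C] has
    characteristic 0. *)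
Lemma trace_anticomm0 (x y : A) : y * x = - (x * y) -> tau (x * y) = 0.
Proof.
move=> xyN; have := tauC x y; rewrite xyN linearN => /eqP.
by rewrite -addr_eq0 -mulr2n mulrn_eq0 /= => /eqP.
Qed.

Variables X Y : A.
Hypothesis YXN : Y * X = - (X * Y).

(** One factor [X] is split off, because it anticommutes with the remaining
    [Y * X ^+ n]. *)
Lemma trace_mul_anticomm n : tau (Y * X ^+ n.+1) = 0.
Proof.
rewrite exprSr mulrA; apply: trace_anticomm0.
by rewrite mulrA -[X * Y]opprK -YXN mulNr -!mulrA -exprSr -exprS.
Qed.

(** [Y] commutes with [X ^+ 2], so only the parity of the exponent matters. *)
Lemma anticomm_odd_exp k : Y * X ^+ (2 * k).+1 = - (X ^+ (2 * k).+1 * Y).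
Proof.
have cYX : GRing.comm Y (X ^+ 2).
  rewrite /GRing.comm expr2 mulrA YXN mulNr -(mulrA X Y) YXN.
  by rewrite mulrN opprK mulrA.
have cYXk : Y * X ^+ (2 * k) = X ^+ (2 * k) * Y.
  by rewrite exprM; apply: commrX.
by rewrite exprSr mulrA cYXk -!mulrA YXN mulrN.
Qed.

Hypothesis XYsqr : X ^+ 2 + Y ^+ 2 = 1.

(** Consecutive odd moments differ by [tau (X ^+ (2 * k).+1 * Y * Y)], a trace
    of a product of the anticommuting elements [X ^+ (2 * k).+1 * Y] and [Y]. *)
Lemma trace_odd_moment k : tau (X ^+ (2 * k).+1) = tau X.
Proof.
elim: k => [|k <-]; first by rewrite muln0 expr1.
have -> : X ^+ (2 * k.+1).+1 = X ^+ (2 * k).+1 - X ^+ (2 * k).+1 * Y * Y.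
  rewrite -mulrA -expr2 -[Y ^+ 2](addKr (X ^+ 2)) XYsqr mulrDr mulr1 mulrN.
  by rewrite opprD opprK addrC subrK -exprD mulnS addnC.
rewrite linearB /= trace_anticomm0 ?subr0 //.
by rewrite mulrA anticomm_odd_exp mulNr.
Qed.

End AnticommutingTrace.

Theorem theorem1 (K : realType) (A : starAlgType K[i]) (tau : {scalar A})
    (tau_state : is_state tau) (tau_tracial : is_tracial tau)
    (P Q : A) (projP : orthogonal_projection P)
    (projQ : orthogonal_projection Q) :
  let R : A := 2 *: P - 1 in
  let S : A := 2 *: Q - 1 in
  let alpha : K[i] := tau R in
  let beta : K[i] := tau S in
  [/\ alpha = 2 * tau P - 1,
      beta = 2 * tau Q - 1 &
      forall j : nat, (1 <= j)%N ->
        2 * tau ((P * Q * P) ^+ j) - (alpha + beta) / 2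
          = 1 / 2 ^+ (2 * j) * tau ((R + S) ^+ (2 * j))
        /\
        1 / 2 ^+ (2 * j) * tau ((R + S) ^+ (2 * j))
          = tau ((P + Q - 1) ^+ (2 * j))].
Proof.
have [tau1 _] := tau_state.
have idemP : P * P = P by rewrite -expr2 -projP.2.
have idemQ : Q * Q = Q by rewrite -expr2 -projQ.2.
move=> R S alpha beta.
have alphaE : alpha = 2 * tau P - 1 by rewrite /alpha linearB linearZ /= tau1.
have betaE : beta = 2 * tau Q - 1 by rewrite /beta linearB linearZ /= tau1.
split=> // j j_gt0.
set X := P + Q - 1.
have two_neq0 : 2 != 0 :> K[i] by rewrite pnatr_eq0.
have RSE : R + S = 2 *: X.
  rewrite /R /S /X scalerBr scalerDr addrACA -opprD.
  by congr (_ - _); rewrite scaler_nat.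
have tauX : (alpha + beta) / 2 = tau X.
  by rewrite /alpha /beta -linearD RSE linearZ /= mulrC mulKf.
have -> : 1 / 2 ^+ (2 * j) * tau ((R + S) ^+ (2 * j)) = tau (X ^+ (2 * j)).
  by rewrite RSE exprZn linearZ /= div1r mulKf // expf_neq0.
split=> //; case: j j_gt0 => // j _.
have YXN := idem_anticomm idemP idemQ.
rewrite idem_compression_exp // tauX mulr_natl mulr2n -linearD -mulrDl.
rewrite (idem_double P Q) -/X 2!mulrDl mul1r 2!linearD /= -exprS.
rewrite (trace_odd_moment tau_tracial YXN (idem_sqrD idemP idemQ)).
by rewrite mulnS (trace_mul_anticomm tau_tracial YXN) addr0 addrK.
Qed.
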